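(* Let $A\in\mathcal{M}_n(\mathbb{C})$ be a normal matrix having the eigenvalues $a_1,\dots,a_n$ (listed with algebraic multiplicity) and let $C\in\mathcal{M}_n(\mathbb{C})$ be a Hermitian matrix such that $AC=CA$. Consider the discrete Lyapunov equation $$(E)\qquad A^{\star}XA-X=C$$ with unknown $X\in\mathcal{M}_n(\mathbb{C})$, and let $\widehat{X}=(AA^\star-I_n)^{\dagger}C$. The following statements hold. (i) $\widehat{X}$ is a Hermitian matrix that commutes with all the matrices in $\{A,A^\star,C\}$. (ii) Any of the following conditions is a necessary and sufficient condition for the consistency of $(E)$: (a) $\widehat{X}$ is a solution of $(E)$; (b) the standard linear equation $(AA^\star-I_n)X=C$ is consistent; (c) $\widehat{X}$ is a solution of the standard linear equation $(AA^\star-I_n)X=C$. (iii) If $(E)$ is consistent, then the dimension of the affine set of its solutions is equal to the cardinality of $\{(r,s)\in\{1,\dots,n\}^2\mid\overline{a}_ra_s=1\}$. (iv) If $(E)$ is consistent, then the following statements are equivalent: (a) all solutions of $(E)$ are normal matrices; (b) if $r,s\in\{1,\dots,n\}$ and $r\neq s$, then $\overline{a}_ra_s\neq 1$. (v) If $AA^\star-I_n$ is invertible, then $\widehat{X}=(AA^\star-I_n)^{-1}C$. In addition, if $X\neq\widehat{X}$ is a solution of $(E)$, then $AX\neq XA$ and $A^\star X\neq XA^\star$.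
   Context: $\mathcal{M}_n(\mathbb{C})$ is the set of complex $n\times n$ matrices and $I_n$ the identity matrix; $M^\star$ is the conjugate transpose of $M$; $M$ is normal if $MM^\star=M^\star M$ and Hermitian if $M=M^\star$. An equation is consistent if it has at least one solution. $M^{\dagger}$ denotes the Moore–Penrose inverse. *)

(* Defs.v *)
From HB Require Import structures.
From mathcomp Require Import all_boot all_order all_algebra.
From mathcomp Require Import sesquilinear spectral.
From mathcomp Require Export reals complex.

Set Implicit Arguments.
Unset Strict Implicit.
Unset Printing Implicit Defensive.

Import Order.TTheory GRing.Theory Num.Theory.

Local Open Scope ring_scope.
Local Open Scope sesquilinear_scope.

Section MoorePenrose.
Variable C : numClosedFieldType.

(* The four Penrose equations. *)
Definition is_mp_inverse m n (M : 'M[C]_(m, n)) (P : 'M[C]_(n, m)) : bool :=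
  [&& M *m P *m M == M, P *m M *m P == P,
      M *m P \is hermsymmx & P *m M \is hermsymmx].

Lemma trCmx_mul m n p (A : 'M[C]_(m, n)) (B : 'M[C]_(n, p)) :
  (A *m B) ^t* = B ^t* *m A ^t*.
Proof. by rewrite trmx_mul map_mxM. Qed.

Lemma hermsymmxE n (A : 'M[C]_n) : (A \is hermsymmx) = (A == A ^t*).
Proof. by rewrite qualifE /= expr0 scale1r. Qed.

Lemma mulmx_trC_eq0 m n (A : 'M[C]_(m, n)) : A *m A ^t* = 0 -> A = 0.
Proof.
move=> A0; apply/matrixP => i j; rewrite mxE.
have /eqP := congr1 (fun M : 'M[C]_m => M i i) A0.
rewrite !mxE psumr_eq0 => [/allP/(_ j (mem_index_enum _))/=|k _].
  by rewrite !mxE -normCK sqrf_eq0 normr_eq0 => /eqP.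
by rewrite !mxE mul_conjC_ge0.
Qed.

Lemma row_free_gram_unit m n (G : 'M[C]_(m, n)) :
  row_free G -> G *m G ^t* \in unitmx.
Proof.
move=> Gfree; rewrite -row_free_unit -kermx_eq0; apply/eqP.
set K := kermx _; have K0 : K *m (G *m G ^t*) = 0 by rewrite mulmx_ker.
have KG0 : K *m G = 0.
  by apply: mulmx_trC_eq0; rewrite trCmx_mul mulmxA -(mulmxA K) K0 mul0mx.
by apply: (row_free_inj Gfree); rewrite /= KG0 mul0mx.
Qed.

Lemma invmx_trC n (A : 'M[C]_n) : (invmx A) ^t* = invmx (A ^t*).
Proof. by rewrite trmx_inv map_invmx. Qed.

Lemma full_rank_mp_inverse m n r (B : 'M[C]_(m, r)) (G : 'M[C]_(r, n)) :
    row_full B -> row_free G ->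
  is_mp_inverse (B *m G)
    (G ^t* *m invmx (G *m G ^t*) *m invmx (B ^t* *m B) *m B ^t*).
Proof.
move=> Bfull Gfree.
have uG := row_free_gram_unit Gfree.
have uB : B ^t* *m B \in unitmx.
  have /row_free_gram_unit : row_free (B ^t*).
    by rewrite /row_free mxrank_map mxrank_tr.
  by rewrite map_trmx trmxK map_mxCK.
set g := invmx (G *m G ^t*); set b := invmx (B ^t* *m B).
have Gg : G *m (G ^t* *m g) = 1%:M by rewrite mulmxA mulmxV.
have bB : b *m B ^t* *m B = 1%:M by rewrite -mulmxA mulVmx.
have gH : g ^t* = g by rewrite invmx_trC trCmx_mul map_trmx trmxK map_mxCK.
have bH : b ^t* = b by rewrite invmx_trC trCmx_mul map_trmx trmxK map_mxCK.
set P := G ^t* *m g *m b *m B ^t*.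
have MP : B *m G *m P = B *m b *m B ^t*.
  by rewrite -mulmxA /P -(mulmxA (_ *m g) b) (mulmxA G) Gg mul1mx mulmxA.
have PM : P *m (B *m G) = G ^t* *m g *m G.
  by rewrite /P -(mulmxA (_ *m g) b) -(mulmxA _ (b *m _)) (mulmxA _ B) bB
    mul1mx.
apply/and4P; split.
- by rewrite MP -2!mulmxA (mulmxA _ B) (mulmxA b) mulVmx ?mul1mx.
- by rewrite PM -(mulmxA _ G) /P -(mulmxA (_ *m g) b) (mulmxA G) Gg mul1mx.
- by rewrite MP hermsymmxE !trCmx_mul bH map_trmx trmxK map_mxCK mulmxA.
- by rewrite PM hermsymmxE !trCmx_mul gH map_trmx trmxK map_mxCK mulmxA.
Qed.

Lemma mp_inverse_exists m n (M : 'M[C]_(m, n)) : exists P, is_mp_inverse M P.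
Proof.
have := full_rank_mp_inverse (col_base_full M) (row_base_free M).
by rewrite mulmx_base => MP; eexists; exact: MP.
Qed.

Definition mp_inverse m n (M : 'M[C]_(m, n)) : 'M[C]_(n, m) :=
  xchoose (mp_inverse_exists M).

Lemma mp_inverseP m n (M : 'M[C]_(m, n)) : is_mp_inverse M (mp_inverse M).
Proof. exact: xchooseP. Qed.

Lemma mp_inverse_uniq m n (M : 'M[C]_(m, n)) P :
  is_mp_inverse M P -> P = mp_inverse M.
Proof.
have /and4P[] := mp_inverseP M; set Q := mp_inverse M.
rewrite !hermsymmxE => /eqP MQM /eqP QMQ /eqP hMQ /eqP hQM.
case/and4P; rewrite !hermsymmxE => /eqP MPM /eqP PMP /eqP hMP /eqP hPM.
have PQ : M *m P = M *m Q.
  by rewrite -[in LHS]MQM -mulmxA hMP hMQ -trCmx_mul mulmxA MPM -hMQ.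
have QP : P *m M = Q *m M.
  by rewrite -[in LHS]MQM !mulmxA -mulmxA hPM hQM -trCmx_mul -mulmxA
    (mulmxA M P) MPM -hQM.
by rewrite -PMP -mulmxA PQ mulmxA QP QMQ.
Qed.

End MoorePenrose.

Definition discrete_lyapunov (C : numClosedFieldType) n
    (A B X : 'M[C]_n) : Prop :=
  A ^t* *m X *m A - X = B.

Definition standard_linear (C : numClosedFieldType) n
    (M B X : 'M[C]_n) : Prop :=
  M *m X = B.

Definition consistent (T : Type) (E : T -> Prop) : Prop := exists X, E X.

(* S = x + U for some point x and some subspace U of dimension d. *)
Definition affine_of_dim (F : fieldType) (V : vectType F)
    (S : V -> Prop) (d : nat) : Prop :=
  exists (x : V) (U : {vspace V}),
    (forall y, S y <-> y - x \in U) /\ \dim U = d.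

(* Main.v *)
(* In an orthonormal eigenbasis of A the operator X |-> A^t* X A - X
   multiplies the (r, s) entry by conj(a_r) a_s - 1, which gives its kernel,
   hence (iii). For (ii), the obstruction N = (1 - M G) C, with G the Moore-
   Penrose inverse of M = A A^t* - 1, is orthogonal to the range of that
   operator, so it vanishes as soon as (E) is consistent; G commutes with
   everything commuting with M, so a solution Xhat = G C of the linear
   equation solves (E). For (iv), if all resonances conj(a_r) a_s = 1 are
   diagonal, a kernel element is normal, commutes with A and is annihilated
   by Xhat; if (r, s) is an off-diagonal one, adding the matching nilpotent
   matrix unit to Xhat and subtracting it cannot both be normal. *)
Require Import Defs.
From mathcomp Require Import all_boot all_order all_algebra.
From mathcomp Require Import perm.
From mathcomp Require Import sesquilinear spectral.

Set Implicit Arguments.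
Unset Strict Implicit.
Unset Printing Implicit Defensive.

Import Order.TTheory GRing.Theory Num.Theory.

Local Open Scope ring_scope.
Local Open Scope sesquilinear_scope.

(** * Similarity and reordering of diagonal matrices *)

Lemma char_poly_conj (K : comUnitRingType) n (P B : 'M[K]_n) :
  P \in unitmx -> char_poly (P *m B *m invmx P) = char_poly B.
Proof.
move=> Pu; rewrite /char_poly /char_poly_mx.
have -> : 'X%:M - map_mx polyC (P *m B *m invmx P) =
    map_mx polyC P *m ('X%:M - map_mx polyC B) *m map_mx polyC (invmx P).
  rewrite mulmxBr mulmxBl -!map_mxM; congr (_ - _).
  by rewrite mul_mx_scalar -scalemxAl -map_mxM mulmxV // map_mx1 scalemx1.
rewrite !det_mulmx mulrAC -det_mulmx -map_mxM mulmxV //.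
by rewrite map_mx1 det1 mul1r.
Qed.

Lemma perm_mx_diag (K : pzSemiRingType) n (s : {perm 'I_n}) (d : 'rV[K]_n) :
  perm_mx s *m diag_mx d = diag_mx (col_perm s d) *m perm_mx s.
Proof.
apply/matrixP => i j; rewrite mul_diag_mx mul_mx_diag !mxE.
by case: eqP => [<-|_]; rewrite ?mulr1 ?mul1r // mulr0 mul0r.
Qed.

(** * Commutation properties of Moore-Penrose inverses *)

Section HermitianMoorePenrose.
Variables (F : numClosedFieldType) (n : nat).
Implicit Types M B N : 'M[F]_n.

Lemma hermsymmxP N : reflect (N ^t* = N) (N \is hermsymmx).
Proof. by rewrite hermsymmxE eq_sym; apply: eqP. Qed.

(** The Penrose equations are stable under conjugate transposition, so uniqueness applies. *)
Lemma mp_inverse_trC M : (mp_inverse M) ^t* = mp_inverse (M ^t*).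
Proof.
apply: mp_inverse_uniq; have /and4P[] := mp_inverseP M; set Q := mp_inverse M.
rewrite !hermsymmxE => /eqP MQM /eqP QMQ /eqP hMQ /eqP hQM.
by apply/and4P; split; rewrite ?hermsymmxE -!trCmx_mul -?mulmxA ?mulmxA;
  rewrite ?MQM ?QMQ -?hMQ -?hQM.
Qed.

Lemma mp_inverse_unit M : M \in unitmx -> mp_inverse M = invmx M.
Proof.
move=> Mu; have /and4P[/eqP MQM _ _ _] := mp_inverseP M.
by rewrite -[LHS](mulKmx Mu) -[X in invmx M *m X](mulmxK Mu) MQM mulmxV ?mulmx1.
Qed.

Variable M : 'M[F]_n.
Hypothesis M_herm : M \is hermsymmx.
Let G := mp_inverse M.

Lemma mp_inverse_herm : G \is hermsymmx.
Proof. by apply/hermsymmxP; rewrite mp_inverse_trC (hermsymmxP _ M_herm). Qed.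

Lemma mp_inverse_mulC : G *m M = M *m G.
Proof.
have /and4P[_ _ /hermsymmxP <- _] := mp_inverseP M.
by rewrite trCmx_mul (hermsymmxP _ M_herm) (hermsymmxP _ mp_inverse_herm).
Qed.

(** The projector [Q = G *m M = M *m G] satisfies [Q B = Q B Q = B Q]. Since [G Q = G = Q G], this
    gives [B G = Q B G = G B Q = G Q B = G B]. *)
Lemma mp_inverse_comm B : B *m M = M *m B -> B *m G = G *m B.
Proof.
move=> BM; have := mp_inverseP M; rewrite -/G => /and4P[/eqP MGM /eqP GMG _ _].
have GM := mp_inverse_mulC.
have QB : G *m M *m B = B *m (G *m M).
  transitivity (G *m M *m B *m (G *m M)).
    by rewrite -(mulmxA G) -BM -!mulmxA (mulmxA M G) MGM.
  by rewrite GM -!mulmxA (mulmxA B M) BM !mulmxA MGM.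
have GQ : G *m (G *m M) = G by rewrite GM mulmxA GMG.
rewrite -[in LHS]GMG mulmxA -QB -(mulmxA G) -BM -!mulmxA -GM -QB.
by rewrite mulmxA GQ.
Qed.

End HermitianMoorePenrose.

Lemma mxtrace_gram_eq0 (F : numClosedFieldType) m n (N : 'M[F]_(m, n)) :
  \tr (N *m N ^t*) = 0 -> N = 0.
Proof.
have ge0 i : 0 <= (N *m N ^t*) i i.
  by rewrite mxE sumr_ge0 // => j _; rewrite !mxE mul_conjC_ge0.
move=> /eqP; rewrite psumr_eq0 => [/allP N0|i _]; last exact: ge0.
apply/matrixP => i j; have := N0 i (mem_index_enum i).
rewrite /= mxE psumr_eq0 => [/allP/(_ j (mem_index_enum j))|k _].
  by rewrite !mxE mul_conjC_eq0 => /eqP.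
by rewrite !mxE mul_conjC_ge0.
Qed.

(** * Spectral theorem with a prescribed order of the eigenvalues *)

Section NormalDiagonalization.
Variables (F : numClosedFieldType) (n : nat) (A : 'M[F]_n) (a : 'I_n -> F).

(** The spectral theorem lists the eigenvalues in its own order. Both lists are the roots of
    [char_poly A], so they differ by a permutation, whose matrix is absorbed into the unitary
    factor. *)
Lemma normalmx_diag_eigenvalues :
    A \is normalmx -> char_poly A = \prod_(r < n) ('X - (a r)%:P) ->
  exists2 P : 'M[F]_n, P \is unitarymx &
    P *m A *m P ^t* = diag_mx (\row_r a r).
Proof.
move=> /orthomx_spectralP A_diag A_char.
have := spectral_unitarymx A; have := spectral_unit A.
move: (spectralmx A) (spectral_diag A) A_diag => P d A_diag Pu P_unitary.
have PAP : P *m A *m invmx P = diag_mx d.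
  by rewrite A_diag !mulmxA mulmxV // mul1mx mulmxK.
have : perm_eq [tuple a r | r < n] [tuple d 0 i | i < n].
  apply: prod_XsubC_eq; rewrite /= !big_map -!enumT !big_enum /= -A_char.
  rewrite -(char_poly_conj A Pu) PAP char_poly_trig ?diag_mx_is_trig //.
  by apply: eq_bigr => i _; rewrite mxE eqxx.
case/tuple_permP => s as_.
have ad : \row_r a r = col_perm s d.
  apply/rowP => r; rewrite !mxE.
  have := congr1 (fun t => tnth t r) (val_inj as_).
  by rewrite !tnth_mktuple.
exists (perm_mx s *m P).
  apply: mul_unitarymx => //; apply/unitarymxP.
  by rewrite tr_perm_mx map_perm_mx -perm_mxM mulgV perm_mx1.
rewrite trCmx_mul -invmx_unitary // !mulmxA -(mulmxA _ P) -(mulmxA _ (P *m A)).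
rewrite PAP perm_mx_diag ad tr_perm_mx map_perm_mx -mulmxA -perm_mxM mulgV.
by rewrite perm_mx1 mulmx1.
Qed.

End NormalDiagonalization.

(** * Matrices diagonal in a common orthonormal basis *)

Section UnitaryDiag.
Variables (F : numClosedFieldType) (n : nat) (P : 'M[F]_n).
Hypothesis P_unitary : P \is unitarymx.
Implicit Types (N : 'M[F]_n) (d : 'rV[F]_n).

Lemma unitary_diagE N d :
  P *m N *m P ^t* = diag_mx d -> N = invmx P *m diag_mx d *m P.
Proof.
have Pu := unitarymx_unit P_unitary.
by move=> <-; rewrite -invmx_unitary // -mulmxA mulmxKV // mulKmx.
Qed.

Lemma unitary_diag_trC N d :
    P *m N *m P ^t* = diag_mx d ->
  P *m N ^t* *m P ^t* = diag_mx (map_mx Num.Def.conjC d).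
Proof.
move=> Nd; rewrite -map_diag_mx -tr_diag_mx -Nd.
by rewrite !trCmx_mul trmxCK mulmxA.
Qed.

Lemma normalmx_unitary_diag N d :
  P *m N *m P ^t* = diag_mx d -> N \is normalmx.
Proof.
by move=> /unitary_diagE Nd; apply/orthomx_spectral_subproof; exists (P, d).
Qed.

Lemma unitary_diag_comm N1 N2 d1 d2 :
    P *m N1 *m P ^t* = diag_mx d1 -> P *m N2 *m P ^t* = diag_mx d2 ->
  N1 *m N2 = N2 *m N1.
Proof.
have Pu := unitarymx_unit P_unitary.
move=> /unitary_diagE -> /unitary_diagE ->; rewrite -!mulmxA !mulKVmx //.
by rewrite !(mulmxA (diag_mx _)) diag_mxC.
Qed.

End UnitaryDiag.

(** * Kernel of the homogeneous Lyapunov operator *)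

Section LyapunovKernel.
Variables (F : numClosedFieldType) (n : nat) (A P : 'M[F]_n) (a : 'I_n -> F).
Hypothesis P_unitary : P \is unitarymx.
Hypothesis A_diag : P *m A *m P ^t* = diag_mx (\row_r a r).
Implicit Types (N X : 'M[F]_n) (r s : 'I_n).

Let PPC : P *m P ^t* = 1%:M. Proof. exact/unitarymxP. Qed.
Let PCP : P ^t* *m P = 1%:M. Proof. exact: mulmx1C. Qed.

(** The matrix units of the eigenbasis of [A]: a basis of eigenvectors of the Lyapunov operator. *)
Definition eigenunit (rs : 'I_n * 'I_n) : 'M[F]_n :=
  P ^t* *m delta_mx rs.1 rs.2 *m P.

Lemma conj_eigenunit rs : P *m eigenunit rs *m P ^t* = delta_mx rs.1 rs.2.
Proof. by rewrite /eigenunit !mulmxA PPC mul1mx -mulmxA PPC mulmx1. Qed.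

Lemma eigenunit_sum N :
  N = \sum_rs (P *m N *m P ^t*) rs.1 rs.2 *: eigenunit rs.
Proof.
have {1}-> : N = P ^t* *m (P *m N *m P ^t*) *m P.
  by rewrite !mulmxA PCP mul1mx -mulmxA PCP mulmx1.
rewrite [in LHS](matrix_sum_delta (P *m N *m P ^t*)) pair_bigA /=.
rewrite mulmx_sumr mulmx_suml; apply: eq_bigr => rs _.
by rewrite -scalemxAr -scalemxAl.
Qed.

Lemma conj_lyapunovE X r s :
  (P *m (A ^t* *m X *m A - X) *m P ^t*) r s =
    ((a r)^* * a s - 1) * (P *m X *m P ^t*) r s.
Proof.
have AP : A *m P ^t* = P ^t* *m diag_mx (\row_r a r).
  by rewrite -A_diag !mulmxA PCP mul1mx.
have PA : P *m A ^t* = diag_mx (\row_r (a r)^*) *m P.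
  rewrite -[P in LHS]trmxCK -trCmx_mul AP trCmx_mul trmxCK.
  rewrite tr_diag_mx map_diag_mx; congr (diag_mx _ *m _).
  by apply/rowP => k; rewrite !mxE.
rewrite mulmxBr mulmxBl !mulmxA PA -(mulmxA _ A) AP !mulmxA.
rewrite mul_mx_diag -!mulmxA mul_diag_mx !mxE mulrBl mul1r.
by rewrite mulrAC.
Qed.

Lemma lyapunov_kerP N :
  A ^t* *m N *m A - N = 0 <->
  forall r s, (a r)^* * a s != 1 -> (P *m N *m P ^t*) r s = 0.
Proof.
split=> [N0 r s ars|N0].
  have /eqP := conj_lyapunovE N r s.
  rewrite N0 mulmx0 mul0mx mxE eq_sym mulf_eq0 subr_eq0 (negPf ars) /=.
  by move/eqP.
rewrite [LHS]eigenunit_sum big1 // => -[r s] _ /=; rewrite conj_lyapunovE.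
have [->|ars] := eqVneq ((a r)^* * a s) 1; first by rewrite subrr mul0r scale0r.
by rewrite N0 // mulr0 scale0r.
Qed.

Lemma lyapunov_ker_eigenunit r s : (a r)^* * a s = 1 ->
  A ^t* *m eigenunit (r, s) *m A - eigenunit (r, s) = 0.
Proof.
move=> ars; apply/lyapunov_kerP => i j; rewrite conj_eigenunit mxE /=.
have [->|//] := eqVneq i r; have [->|//] := eqVneq j s.
by rewrite ars eqxx.
Qed.

(** The two products with the adjoint are the diagonal units at [r] and at [s], which differ in
    entry [(r, r)]. *)
Lemma eigenunit_nonnormal r s : r != s -> eigenunit (r, s) \isn't normalmx.
Proof.
move=> rs; apply/negP => /normalmxP.
have -> : (eigenunit (r, s)) ^t* = eigenunit (s, r).
  by rewrite !trCmx_mul trmxCK trmx_delta map_delta_mx mulmxA.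
move/(congr1 (fun N => (P *m N *m P ^t*) r r)).
have mulE k l : eigenunit (k, l) *m eigenunit (l, k) = eigenunit (k, k).
  rewrite /eigenunit /= -!mulmxA (mulmxA P) PPC mul1mx.
  by rewrite (mulmxA (delta_mx k l)) mul_delta_mx.
rewrite !mulE !conj_eigenunit !mxE eqxx (negPf rs) => /eqP.
by rewrite oner_eq0.
Qed.

Lemma lyapunov_ker_diag N :
    (forall r s, r != s -> (a r)^* * a s != 1) ->
    A ^t* *m N *m A - N = 0 ->
  exists d : 'rV_n, P *m N *m P ^t* = diag_mx d.
Proof.
move=> ars /lyapunov_kerP N0; apply/diag_mxP/is_diag_mxP => r s rs.
exact/N0/ars.
Qed.

(** The units [eigenunit (r, s)] at resonant pairs form a basis of the kernel. *)
Lemma lyapunov_ker_dim : exists U : {vspace 'M[F]_n},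
  (forall N, A ^t* *m N *m A - N = 0 <-> N \in U) /\
  \dim U = #|[set rs : 'I_n * 'I_n | (a rs.1)^* * a rs.2 == 1]|.
Proof.
set S := [set rs | _].
pose B := [tuple eigenunit (enum_val i) | i < #|S|].
have nthB (i : 'I_#|S|) : B`_i = eigenunit (enum_val i).
  by rewrite -tnth_nth tnth_mktuple.
exists <<B>>%VS; split=> [N|].
  split=> [/lyapunov_kerP N0|/coord_span ->].
    rewrite [N]eigenunit_sum; apply: memv_suml => rs _.
    have [Srs|] := boolP (rs \in S).
      apply: memvZ; apply: memv_span; apply/tnthP.
      by exists (enum_rank_in Srs rs); rewrite tnth_mktuple enum_rankK_in.
    by rewrite inE => ?; rewrite N0 // scale0r mem0v.
  rewrite mulmx_sumr mulmx_suml -sumrB big1 // => i _.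
  rewrite nthB -scalemxAr -scalemxAl -scalerBr.
  have := enum_valP i; case: (enum_val i) => r s; rewrite inE => /eqP ars.
  by rewrite lyapunov_ker_eigenunit // scaler0.
suff /eqnP : free B by rewrite size_tuple.
apply/freeP => k /(congr1 (fun N => P *m N *m P ^t*)) Bk i.
(* Conjugated by [P], the relation involves distinct matrix units, so this entry isolates [k i]. *)
have /matrixP/(_ (enum_val i).1 (enum_val i).2) := Bk.
rewrite mulmx0 mul0mx mulmx_sumr mulmx_suml summxE mxE (bigD1 i) //=.
rewrite big1 => [|j ji]; rewrite nthB -scalemxAr -scalemxAl conj_eigenunit !mxE.
  by rewrite !eqxx mulr1 addr0.
rewrite -xpair_eqE -!surjective_pairing (inj_eq enum_val_inj) eq_sym.
by rewrite (negPf ji) mulr0.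
Qed.

End LyapunovKernel.

(** * The candidate [Xhat] and the consistency of the equation *)

Section HermitianLyapunov.
Variables (F : numClosedFieldType) (n : nat) (A C : 'M[F]_n).
Hypothesis A_normal : A \is normalmx.
Hypothesis C_herm : C \is hermsymmx.
Hypothesis AC_comm : A *m C = C *m A.
Let M := A *m A ^t* - 1%:M.
Let G := mp_inverse M.
Let Xhat := G *m C.

Let AAC : A *m A ^t* = A ^t* *m A. Proof. exact/normalmxP. Qed.

Let CH : C ^t* = C. Proof. exact/hermsymmxP. Qed.

Let AC_C : A ^t* *m C = C *m A ^t*.
Proof. by rewrite -{1}CH -trCmx_mul -AC_comm trCmx_mul CH. Qed.

Let M_herm : M \is hermsymmx.
Proof.
apply/hermsymmxP.
by rewrite linearB /= map_mxB trCmx_mul trmxCK trmx1 map_mx1.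
Qed.

Let commM (B : 'M[F]_n) :
  B *m A = A *m B -> B *m A ^t* = A ^t* *m B -> B *m M = M *m B.
Proof.
move=> BA BAC; rewrite mulmxBr mulmxBl mulmx1 mul1mx.
by rewrite mulmxA BA -mulmxA BAC mulmxA.
Qed.

Let MA : A *m M = M *m A. Proof. exact: commM. Qed.
Let MAC : A ^t* *m M = M *m A ^t*. Proof. exact: commM. Qed.
Let MC : C *m M = M *m C. Proof. exact: commM. Qed.

Lemma Xhat_herm : Xhat \is hermsymmx.
Proof.
apply/hermsymmxP; rewrite trCmx_mul CH (hermsymmxP _ (mp_inverse_herm M_herm)).
exact: mp_inverse_comm.
Qed.

Lemma Xhat_comm (B : 'M[F]_n) :
  B *m M = M *m B -> B *m C = C *m B -> Xhat *m B = B *m Xhat.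
Proof.
by move=> BM BC; rewrite -mulmxA -BC !mulmxA (mp_inverse_comm M_herm BM).
Qed.

Lemma XhatA : Xhat *m A = A *m Xhat. Proof. exact: Xhat_comm. Qed.
Lemma XhatAC : Xhat *m A ^t* = A ^t* *m Xhat. Proof. exact: Xhat_comm. Qed.
Lemma XhatC : Xhat *m C = C *m Xhat. Proof. exact: Xhat_comm. Qed.

(** This is the bridge to the linear equation: on the commutant of [A] the Lyapunov operator is left
    multiplication by [M]. *)
Lemma lyapunov_comm X : A *m X = X *m A -> A ^t* *m X *m A - X = M *m X.
Proof. by move=> AX; rewrite mulmxBl mul1mx AAC -!mulmxA AX. Qed.

Lemma lyapunov_commC X : A ^t* *m X = X *m A ^t* ->
  A ^t* *m X *m A - X = X *m M.
Proof. by move=> AX; rewrite mulmxBr mulmx1 AAC mulmxA AX. Qed.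

Lemma Xhat_linear_of_consistent_linear :
  consistent (standard_linear M C) -> standard_linear M C Xhat.
Proof.
have /and4P[/eqP MGM _ _ _] := mp_inverseP M; rewrite -/G in MGM.
by case=> X LX; rewrite /standard_linear /Xhat -LX !mulmxA MGM.
Qed.

(* [N = (1 - M G) C] is Hermitian and [A N A^t* = N], hence [N] is
   trace-orthogonal to every [A^t* X A - X], in particular to [C]; but
   [tr (N C)] is the squared Frobenius norm of [N]. *)
Lemma Xhat_linear_of_consistent :
  consistent (discrete_lyapunov A C) -> standard_linear M C Xhat.
Proof.
case=> X EX; have /and4P[/eqP MGM _ /hermsymmxP KH _] := mp_inverseP M.
rewrite -/G in MGM KH.
pose N := C - M *m Xhat.
have MN : M *m N = 0 
  by rewrite mulmxBr /Xhat (mulmxA M G) -mp_inverse_mulC // !mulmxA MGM subrr.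
have NH : N ^t* = N.
  rewrite linearB /= map_mxB CH trCmx_mul (hermsymmxP _ Xhat_herm).
  rewrite (hermsymmxP _ M_herm); congr (_ - _).
  exact: Xhat_comm.
have NA : N *m A = A *m N.
  by rewrite mulmxBl mulmxBr -AC_comm -mulmxA XhatA !mulmxA MA.
(* The adjoint of [M N = 0] is [N M = 0], that is [N A A^t* = N]; then [N] is moved past [A]. *)
have ANA : A *m N *m A ^t* = N.
  have := MN; rewrite -[M *m N]trmxCK trCmx_mul NH (hermsymmxP _ M_herm).
  move/(congr1 (fun B => B ^t*)); rewrite trmxCK trmx0 map_mx0.
  by rewrite mulmxBr mulmx1 mulmxA NA => /subr0_eq.
(* By cyclicity, [tr (N A^t* X A) = tr (A N A^t* X) = tr (N X)]. *)
have trNC : \tr (N *m C) = 0.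
  rewrite -EX mulmxBr linearB /= !mulmxA mxtrace_mulC !mulmxA.
  by rewrite ANA subrr.
have trNMX : \tr (N *m (M *m Xhat)) = 0.
  by rewrite mulmxA mxtrace_mulC -[N]NH -(hermsymmxP _ M_herm) -trCmx_mul MN
    trmx0 map_mx0 mulmx0 mxtrace0.
apply/esym/subr0_eq/mxtrace_gram_eq0; rewrite -/N NH {2}/N.
by rewrite mulmxBr linearB /= trNC trNMX subrr.
Qed.

Lemma Xhat_lyapunov :
  standard_linear M C Xhat -> discrete_lyapunov A C Xhat.
Proof.
by move=> LX; rewrite /discrete_lyapunov lyapunov_comm // XhatA.
Qed.

Lemma lyapunov_sub_ker X :
  discrete_lyapunov A C Xhat ->
  discrete_lyapunov A C X <->
    A ^t* *m (X - Xhat) *m A - (X - Xhat) = 0.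
Proof.
rewrite /discrete_lyapunov => EXh.
have -> : A ^t* *m (X - Xhat) *m A - (X - Xhat) =
      A ^t* *m X *m A - X - C.
  by rewrite -EXh mulmxBr mulmxBl !opprD addrACA.
by split=> [-> | /subr0_eq //]; rewrite subrr.
Qed.

(** As [G = G M G], a factor [M] can be brought to either end of [Xhat], so [Xhat] and [N]
    annihilate each other. Taking adjoints, so do [Xhat] and [N^t*], and all cross terms in the
    normality identity vanish. *)
Lemma normal_Xhat_add N : N *m A = A *m N -> N \is normalmx ->
  M *m N = 0 -> N *m M = 0 -> Xhat + N \is normalmx.
Proof.
move=> NA /normalmxP NN MN NM; have /and4P[_ /eqP GMG _ _] := mp_inverseP M.
rewrite -/G in GMG.
have GM := mp_inverse_mulC M_herm; rewrite -/G in GM.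
have XhH := hermsymmxP _ Xhat_herm.
have CG : C *m G = G *m C by exact: mp_inverse_comm.
have XN : Xhat *m N = 0.
  by rewrite /Xhat -CG -GMG -(mulmxA G) -GM -!mulmxA MN !mulmx0.
have NX : N *m Xhat = 0.
  by rewrite /Xhat -GMG GM !mulmxA NM !mul0mx.
have XNC : Xhat *m N ^t* = 0.
  by rewrite -XhH -trCmx_mul NX trmx0 map_mx0.
have NCX : N ^t* *m Xhat = 0.
  by rewrite -XhH -trCmx_mul XN trmx0 map_mx0.
apply/normalmxP; rewrite linearD /= map_mxD XhH !mulmxDl !mulmxDr.
by rewrite XN NX XNC NCX NN.
Qed.

End HermitianLyapunov.

(** Adding the two normality identities cancels the cross terms and leaves [2 N N^t* = 2 N^t* N]. *)
Lemma normalmx_of_normal_add_sub (F : numClosedFieldType) n (H N : 'M[F]_n) :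
  H \is hermsymmx -> H + N \is normalmx -> H - N \is normalmx ->
  N \is normalmx.
Proof.
move=> /hermsymmxP HH /normalmxP HpN /normalmxP HmN; apply/normalmxP.
have HYZ Y Z : (H + Y) *m (H + Z) + (H - Y) *m (H - Z) =
    (H *m H) *+ 2 + (Y *m Z) *+ 2.
  rewrite !mulmxDl !mulmxDr !mulmxN !mulNmx opprK addrACA.
  rewrite [X in X + _]addrACA [X in _ + X]addrACA !subrr addr0 add0r.
  by rewrite -!mulr2n.
have := congr2 +%R HpN HmN.
have HD Y : (H + Y) ^t* = H + Y ^t* by rewrite linearD /= map_mxD HH.
have NN : (- N) ^t* = - N ^t* by rewrite linearN /= map_mxN.
rewrite !HD NN !HYZ => /addrI.
by rewrite -!scaler_nat => /scalerI; apply; rewrite pnatr_eq0.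
Qed.


Theorem theorem4p2 (R : realType) (n : nat) (A C : 'M[R[i]]_n)
  (a : 'I_n -> R[i])
  (A_normal : A \is normalmx)
  (A_eigenvalues : char_poly A = \prod_(r < n) ('X - (a r)%:P))
  (C_hermitian : C \is hermsymmx)
  (AC_comm : A *m C = C *m A) :
  let M := A *m A ^t* - 1%:M in
  let Xhat := mp_inverse M *m C in
  let E := discrete_lyapunov A C in
  let L := standard_linear M C in
  [/\ (* (i) *)
      [/\ Xhat \is hermsymmx,
          Xhat *m A = A *m Xhat,
          Xhat *m A ^t* = A ^t* *m Xhat &
          Xhat *m C = C *m Xhat],
      (* (ii) *)
      [/\ consistent E <-> E Xhat,
          consistent E <-> consistent L &
          consistent E <-> L Xhat],
      (* (iii) *)
      consistent E ->
        affine_of_dim E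
          #|[set rs : 'I_n * 'I_n | (a rs.1)^* * a rs.2 == 1]|,
      (* (iv) *)
      consistent E ->
        ((forall X, E X -> X \is normalmx) <->
         (forall r s : 'I_n, r != s -> (a r)^* * a s != 1)) &
      (* (v) *)
      M \in unitmx ->
        Xhat = invmx M *m C /\
        (forall X, E X -> X <> Xhat ->
           A *m X <> X *m A /\ A ^t* *m X <> X *m A ^t*)].
Proof.
move=> M Xhat E L.
have [P P_unitary A_diag] := normalmx_diag_eigenvalues A_normal A_eigenvalues.
have XhH : Xhat \is hermsymmx by exact: Xhat_herm.
have XhA : Xhat *m A = A *m Xhat by exact: XhatA.
have XhAC : Xhat *m A ^t* = A ^t* *m Xhat by exact: XhatAC.
have EL : consistent E -> L Xhat by exact: Xhat_linear_of_consistent.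
have LE : L Xhat -> E Xhat by exact: Xhat_lyapunov.
have LL : consistent L -> L Xhat by exact: Xhat_linear_of_consistent_linear.
have EX X : consistent E -> E X <->
    A ^t* *m (X - Xhat) *m A - (X - Xhat) = 0.
  by move=> /EL /LE; exact: lyapunov_sub_ker.
have M_sub N : A *m N = N *m A -> A ^t* *m N = N *m A ^t* ->
    A ^t* *m N *m A - N = 0 -> M *m N = 0 /\ N *m M = 0.
  move=> AN ACN N0; rewrite -(lyapunov_comm A_normal AN).
  by rewrite -(lyapunov_commC A_normal ACN).
split.
- by split=> //; exact: XhatC.
- split; split.
  + by move=> /EL /LE.
  + by move=> ?; exists Xhat.
  + by move=> /EL ?; exists Xhat.
  + by move=> /LL /LE ?; exists Xhat.
  + exact: EL.
  + by move=> /LE ?; exists Xhat.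
- move=> cE; have [U [UP dimU]] := lyapunov_ker_dim P_unitary A_diag.
  exists Xhat, U; split=> // X; rewrite (EX _ cE); exact: UP.
- move=> cE; split=> [allN r s rs|ars X /(EX _ cE)].
    (* An off-diagonal resonance would make [Xhat] plus and minus its unit two solutions, hence both
       normal, forcing the unit itself to be normal. *)
    apply/negP => /eqP /(lyapunov_ker_eigenunit P_unitary A_diag) N0.
    have /negP := eigenunit_nonnormal P_unitary rs; apply.
    apply: (normalmx_of_normal_add_sub XhH).
      by apply/allN/(EX _ cE); rewrite addrAC subrr add0r.
    apply/allN/(EX _ cE); rewrite addrAC subrr add0r.
    by rewrite mulmxN mulNmx -opprD N0 oppr0.
  set N := X - Xhat => N0.
  (* Being diagonal in the eigenbasis, [N] is normal and commutes with [A] and [A^t*], so [M] kills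
     it on both sides. *)
  have [d Nd] := lyapunov_ker_diag P_unitary A_diag ars N0.
  have N_normal : N \is normalmx by exact: normalmx_unitary_diag Nd.
  have AN := unitary_diag_comm P_unitary A_diag Nd.
  have [|MN NM] := M_sub N AN _ N0.
    exact: unitary_diag_comm (unitary_diag_trC A_diag) Nd.
  by rewrite -[X](subrKC Xhat); exact: normal_Xhat_add.
- move=> Mu; split; first by rewrite /Xhat mp_inverse_unit.
  have MX : M *m Xhat = C by rewrite /Xhat mp_inverse_unit // mulKVmx.
  (* Commuting with [A] turns the equation into [M X = C = M Xhat], and commuting with [A^t*] into
     [X M = C = Xhat M]; in both cases [M] cancels. *)
  move=> X EX0 XX; split=> AX; apply: XX.
    by apply: (can_inj (mulKmx Mu)); rewrite MX -(lyapunov_comm A_normal AX).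
  apply: (can_inj (mulmxK Mu)); rewrite -(lyapunov_commC A_normal AX) EX0.
  by rewrite -(lyapunov_commC A_normal (esym XhAC)) (LE MX).
Qed.
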